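(* Let $k\ge 2$, $s\ge 2$, $i\ge 1$, $j\ge 1$, $t\ge 0$ be integers. Let $G_0$ be a graph with $|V(G_0)|=k+s-2$ which contains a complete subgraph $K_k$ on $k$ vertices (fix such a $K_k$). Let $G_1$ be a graph obtained from $G_0$ by adding two new vertices $u$ and $v$, joining $u$ to $i+t$ vertices of this $K_k$, joining $v$ to $j$ vertices of this $K_k$, and joining $u$ to $v$ (and adding no other edges), in such a way that $|N_{G_1}(u)\cup N_{G_1}(v)|=k+2$ and $|N_{G_1}(u)\cap N_{G_1}(v)|=t$. Let $G_2=(G_1-v)\cup K_1$. If $t<j$ and $$i> \frac{j^{3}+2(s-t-1)j^2+(t^2+2t-2ts+s^2-s)j+s^2-s}{j-t},$$ then $\mu(G_1)<\mu(G_2)$.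
   Context: All graphs are finite and simple. For a graph $G$ and $x\in V(G)$, $N_G(x)$ denotes the set of neighbors of $x$ in $G$, and $G-x$ is the graph obtained by removing $x$ together with all edges incident with it. $K_m$ is the complete graph on $m$ vertices, and $(G-x)\cup K_1$ denotes the disjoint union of $G-x$ with a single isolated vertex. For a positive integer $\lambda$, a proper $\lambda$-coloring of $G$ is a map $c:V(G)\to\{1,\ldots,\lambda\}$ with $c(x)\ne c(y)$ whenever $xy\in E(G)$. For an $n$-vertex graph $G$, the mean color number $\mu(G)$ is the average, over all proper $n$-colorings $c$ of $G$, of the number of colors actually used by $c$ (that is, of $|c(V(G))|$). Equivalently, $$\mu(G)=\frac{\sum_{k=1}^{n}k\,\alpha(G,k)(n)_{k}}{\sum_{k=1}^{n}\alpha(G,k)(n)_{k}},$$ where $\alpha(G,k)$ is the number of partitions of $V(G)$ into exactly $k$ nonempty independent sets and $(n)_k=n(n-1)\cdots(n-k+1)$. *)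

(* Defs.v *)
From mathcomp Require Import all_boot all_order all_algebra.

Set Implicit Arguments.
Unset Strict Implicit.
Unset Printing Implicit Defensive.

Import Order.TTheory GRing.Theory Num.Theory.

Record sgraph := SGraph {
  vertex :> finType;
  adj : rel vertex;
  adj_sym : symmetric adj;
  adj_irrefl : irreflexive adj
}.

Definition nbhd (G : sgraph) (x : G) : {set G} := [set y | adj x y].

Definition is_clique (G : sgraph) (K : {set G}) : Prop :=
  {in K &, forall x y, x != y -> adj x y}.

Section Constructions.
Variable G : sgraph.

(* [Some] embeds G; [None] is the new vertex, with neighbourhood S. *)
Definition add_vertex_adj (S : {set G}) : rel (option G) := fun x y =>
  match x, y with
  | Some a, Some b => adj a b
  | Some a, None | None, Some a => a \in S
  | None, None => false
  end.

Fact add_vertex_sym (S : {set G}) : symmetric (add_vertex_adj S).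
Proof. by move=> [a|] [b|] //=; exact: adj_sym. Qed.

Fact add_vertex_irrefl (S : {set G}) : irreflexive (add_vertex_adj S).
Proof. by move=> [a|] //=; exact: adj_irrefl. Qed.

Definition add_vertex (S : {set G}) : sgraph :=
  SGraph (add_vertex_sym S) (add_vertex_irrefl S).

Definition del_vertex_adj (x : G) : rel {y : G | y != x} := fun a b =>
  adj (val a) (val b).

Fact del_vertex_sym (x : G) : symmetric (@del_vertex_adj x).
Proof. by move=> a b; exact: adj_sym. Qed.

Fact del_vertex_irrefl (x : G) : irreflexive (@del_vertex_adj x).
Proof. by move=> a; exact: adj_irrefl. Qed.

Definition del_vertex (x : G) : sgraph :=
  SGraph (@del_vertex_sym x) (@del_vertex_irrefl x).

Variable H : sgraph.

Definition disjoint_union_adj : rel (G + H)%type := fun x y =>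
  match x, y with
  | inl a, inl b => adj a b
  | inr a, inr b => adj a b
  | _, _ => false
  end.

Fact disjoint_union_sym : symmetric disjoint_union_adj.
Proof. by move=> [a|a] [b|b] //=; exact: adj_sym. Qed.

Fact disjoint_union_irrefl : irreflexive disjoint_union_adj.
Proof. by move=> [a|a] /=; exact: adj_irrefl. Qed.

Definition disjoint_union : sgraph :=
  SGraph disjoint_union_sym disjoint_union_irrefl.

End Constructions.

Definition complete_adj (m : nat) : rel 'I_m := fun x y => x != y.

Fact complete_sym (m : nat) : symmetric (@complete_adj m).
Proof. by move=> x y; rewrite /complete_adj eq_sym. Qed.

Fact complete_irrefl (m : nat) : irreflexive (@complete_adj m).
Proof. by move=> x; rewrite /complete_adj eqxx. Qed.

Definition complete (m : nat) : sgraph :=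
  SGraph (@complete_sym m) (@complete_irrefl m).

Definition proper_colorings (G : sgraph) (l : nat) : {set {ffun G -> 'I_l}} :=
  [set c : {ffun G -> 'I_l} |
    [forall x, forall y, adj x y ==> (c x != c y)]].

(* The denominator is never 0: a bijection from G to 'I_#|G| is proper. *)
Definition mean_color_number (G : sgraph) : rat :=
  ((\sum_(c in proper_colorings G #|G|) #|c @: [set: G]|)%:R
     / #|proper_colorings G #|G| |%:R)%R.

(* G0 together with u, joined to A, and v, joined to B and to u. *)
Definition add_edge_pair (G0 : sgraph) (A B : {set G0}) : sgraph :=
  @add_vertex (add_vertex A) (None |: [set Some b | b in B]).

Definition pair_u (G0 : sgraph) (A B : {set G0}) : add_edge_pair A B :=
  Some None.

Definition pair_v (G0 : sgraph) (A B : {set G0}) : add_edge_pair A B :=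
  None.

(* Main.v *)
(** The number of colors missed by a coloring is counted color by color: since
    the [n]-colorings avoiding a given color are the [n-1]-colorings,
    [mu(G) = n (1 - P(G, n-1) / P(G, n))], where [P] is the chromatic
    polynomial.  As [A] and [B] cover the clique [K], whose colors are distinct,
    [P(G1, l) = P(G0, l) ((l - |A|) (l - |B|) - (l - |K|))] and
    [P(G2, l) = P(G0, l) (l - |A|) l].  After clearing denominators the
    inequality between the two ratios is exactly the hypothesis on [i]. *)

Require Import Defs.
From mathcomp Require Import all_boot all_order all_algebra.
From mathcomp Require Import ring lra zify.

Import Order.TTheory GRing.Theory Num.Theory.
Local Open Scope ring_scope.

(** * Proper colorings: existence, cliques, isomorphism *)

Lemma proper_coloringsP (G : sgraph) (l : nat) (c : {ffun G -> 'I_l}) :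
  reflect (forall x y, adj x y -> c x != c y) (c \in proper_colorings G l).
Proof.
rewrite inE; apply: (iffP forallP) => [h x y xy|h x].
  by move/forallP: (h x) => /(_ y)/implyP; apply.
by apply/forallP => y; apply/implyP; apply: h.
Qed.

Lemma proper_colorings_gt0 (G : sgraph) (l : nat) :
  (#|G| <= l)%N -> (0 < #|proper_colorings G l|)%N.
Proof.
move=> Gl; apply/card_gt0P.
exists [ffun x => widen_ord Gl (enum_rank x)].
apply/proper_coloringsP => x y xy; rewrite !ffunE.
apply: contraTneq xy => /(congr1 val) /= /val_inj /enum_rank_inj ->.
by rewrite adj_irrefl.
Qed.

Lemma proper_coloring_clique_inj {G : sgraph} {l : nat} {c : {ffun G -> 'I_l}}
    {K : {set G}} :
  c \in proper_colorings G l -> is_clique K -> {in K &, injective c}.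
Proof.
move=> /proper_coloringsP cP hK x y xK yK cxy; apply/eqP.
by apply: contraT => /(hK _ _ xK yK)/cP; rewrite cxy eqxx.
Qed.

Lemma card_proper_colorings_iso (G H : sgraph) (f : G -> H) (l : nat) :
  bijective f -> (forall x y, adj (f x) (f y) = adj x y) ->
  #|proper_colorings G l| = #|proper_colorings H l|.
Proof.
move=> [g fK gK] fadj.
pose F (c : {ffun H -> 'I_l}) : {ffun G -> 'I_l} := [ffun x => c (f x)].
pose F' (c : {ffun G -> 'I_l}) : {ffun H -> 'I_l} := [ffun x => c (g x)].
have FK : cancel F F' by move=> c; apply/ffunP => x; rewrite !ffunE gK.
have F'K : cancel F' F by move=> c; apply/ffunP => x; rewrite !ffunE fK.
rewrite -(card_imset _ (can_inj FK)); congr #|pred_of_set _|; apply/setP => c.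
apply/idP/imsetP => [cP|[d dP ->]].
  exists (F' c); last by rewrite F'K.
  apply/proper_coloringsP => x y xy; rewrite !ffunE.
  by move/proper_coloringsP: cP; apply; rewrite -fadj !gK.
apply/proper_coloringsP => x y xy; rewrite !ffunE.
by move/proper_coloringsP: dP; apply; rewrite fadj.
Qed.

(** * The mean color number through coloring counts *)

(** Composition with [lift a], the increasing injection of ['I_l] into ['I_l.+1] that skips [a], is
    the bijection. *)
Lemma card_proper_colorings_avoiding (G : sgraph) (l : nat) (a : 'I_l.+1) :
  #|[set c in proper_colorings G l.+1 | a \notin c @: [set: G]]| =
  #|proper_colorings G l|.
Proof.
pose F (c : {ffun G -> 'I_l}) : {ffun G -> 'I_l.+1} := [ffun x => lift a (c x)].
have F_inj : injective F.
  move=> c d /ffunP cd; apply/ffunP => x.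
  by move: (cd x); rewrite !ffunE => /lift_inj.
rewrite -(card_imset _ F_inj); congr #|pred_of_set _|; apply/setP => c.
apply/setIdP/imsetP => [[/proper_coloringsP cP ac]|[d /proper_coloringsP dP ->]].
  have ac' x : a != c x.
    by apply: contraNneq ac => ->; apply/imsetP; exists x.
  have lx x : {y | c x = lift a y}.
    by case: (unlift_some (ac' x)) => y; exists y.
  exists [ffun x => sval (lx x)].
    apply/proper_coloringsP => x y /cP; rewrite !ffunE.
    by apply: contraNneq => e; rewrite (svalP (lx x)) e -(svalP (lx y)).
  by apply/ffunP => x; rewrite !ffunE -(svalP (lx x)).
split.
  apply/proper_coloringsP => x y /dP; rewrite !ffunE.
  by rewrite (inj_eq lift_inj).
by apply/imsetP => -[x _]; rewrite ffunE => /eqP; rewrite (negPf (neq_lift _ _)).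
Qed.

(** Double counting of the pairs of a coloring and a color it misses. The additive form avoids
    truncated subtraction. *)
Lemma sum_card_colors_used (G : sgraph) (l : nat) :
  (\sum_(c in proper_colorings G l.+1) #|c @: [set: G]|
     + l.+1 * #|proper_colorings G l| = l.+1 * #|proper_colorings G l.+1|)%N.
Proof.
have <- : (\sum_(c in proper_colorings G l.+1) #|~: (c @: [set: G])|
    = l.+1 * #|proper_colorings G l|)%N.
  under eq_bigr do rewrite -sum1_card big_mkcond /=.
  rewrite exchange_big /= -[X in (_ = X * _)%N]card_ord -sum_nat_const.
  apply: eq_bigr => a _.
  rewrite -(@card_proper_colorings_avoiding G l a) -sum1_card -big_mkcondr /=.
  by apply: eq_bigl => c; rewrite !inE.
rewrite -big_split mulnC -sum_nat_const; apply: eq_bigr => c _.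
by rewrite /= cardsC card_ord.
Qed.

Lemma mean_color_numberE (G : sgraph) (l : nat) : #|G| = l.+1 ->
  mean_color_number G =
  l.+1%:R * (1 - #|proper_colorings G l|%:R / #|proper_colorings G l.+1|%:R).
Proof.
move=> hG; rewrite /mean_color_number hG.
have : #|proper_colorings G l.+1|%:R != 0 :> rat.
  by rewrite pnatr_eq0 -lt0n proper_colorings_gt0 ?hG.
have /(congr1 (fun m => m%:R : rat)) := sum_card_colors_used G l.
rewrite natrD !natrM => /(canRL (addrK _)) -> nz.
by field.
Qed.

(** * Colorings of a graph with one added vertex *)

Definition extend_coloring {G : sgraph} {l : nat} (c : {ffun G -> 'I_l})
    (a : 'I_l) : {ffun option G -> 'I_l} :=
  [ffun x => if x is Some y then c y else a].

Lemma extend_coloring_proper (G : sgraph) (S : {set G}) (l : nat)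
    (c : {ffun G -> 'I_l}) (a : 'I_l) :
  (extend_coloring c a \in proper_colorings (add_vertex S) l) =
  (c \in proper_colorings G l) && (a \notin c @: S).
Proof.
apply/proper_coloringsP/andP => [h|[/proper_coloringsP cP aS]].
  split.
    by apply/proper_coloringsP => x y xy; have := h (Some x) (Some y) xy;
       rewrite !ffunE.
  by apply/imsetP => -[x xS ax]; have := h (Some x) None xS;
     rewrite !ffunE ax eqxx.
move=> [x|] [y|] //=; rewrite !ffunE => xy; first exact: cP.
  by apply: contraNneq aS => <-; apply: imset_f.
by apply: contraNneq aS => ->; apply: imset_f.
Qed.

(** The summand [F] is arbitrary so that the lemma can be iterated: when [v] is added after [u], the
    number of colors left for [v] depends on the color of [u]. *)
Lemma sum_proper_colorings_add_vertex (V : nmodType) (G : sgraph) (S : {set G})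
    (l : nat) (F : {ffun option G -> 'I_l} -> V) :
  \sum_(c in proper_colorings (add_vertex S) l) F c =
  \sum_(c in proper_colorings G l) \sum_(a in ~: (c @: S))
    F (extend_coloring c a).
Proof.
pose h (p : {ffun G -> 'I_l} * 'I_l) := extend_coloring p.1 p.2.
pose h' (d : {ffun option G -> 'I_l}) := ([ffun x => d (Some x)], d None).
have hK : cancel h h'.
  move=> [c a]; congr pair; last by rewrite ffunE.
  by apply/ffunP => x; rewrite !ffunE.
have h'K : cancel h' h.
  by move=> d; apply/ffunP => -[x|]; rewrite !ffunE.
rewrite pair_big_dep /= (reindex h) /=; last by apply: onW_bij; exists h'.
apply: eq_bigl => -[c a]; rewrite /h extend_coloring_proper /=.
by congr (_ && _); rewrite in_setC.
Qed.

Lemma card_proper_colorings_add_vertex (G : sgraph) (S : {set G}) (l : nat) :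
  #|proper_colorings (add_vertex S) l|%:R =
  \sum_(c in proper_colorings G l) #|~: (c @: S)|%:R :> rat.
Proof.
rewrite -sum1_card natr_sum sum_proper_colorings_add_vertex.
by apply: eq_bigr => c _; rewrite -natr_sum sum1_card.
Qed.

Lemma cardsC_natr (l : nat) (S : {set 'I_l}) :
  #|~: S|%:R = l%:R - #|S|%:R :> rat.
Proof.
by rewrite -[X in X%:R - _]card_ord -(cardsC S) natrD addrAC subrr add0r.
Qed.

(** * Coloring counts of the two graphs compared *)

Section EdgePair.

Variables (G0 : sgraph) (K A B : {set G0}).
Hypotheses (hK : is_clique K) (hAK : A \subset K) (hABK : A :|: B = K).

(** This makes the number of extensions independent of the coloring [c] of [G0]. *)
Let card_clique_imset l (c : {ffun G0 -> 'I_l}) (S : {set G0}) :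
  c \in proper_colorings G0 l -> S \subset K -> #|c @: S| = #|S|.
Proof.
move=> cP SK; apply: card_in_imset.
exact: sub_in2 (subsetP SK) _ (proper_coloring_clique_inj cP hK).
Qed.

(** Fix a coloring [c] of [G0]. If [u] gets a color [a] outside [c @: A], then [v] has [l - |B|]
    choices, and one fewer when [a] is also outside [c @: B]. The colors [a] causing this loss are
    those outside [c @: K]. *)
Lemma card_proper_colorings_add_edge_pair (l : nat) :
  #|proper_colorings (add_edge_pair A B) l|%:R =
  #|proper_colorings G0 l|%:R *
    ((l%:R - #|A|%:R) * (l%:R - #|B|%:R) - (l%:R - #|K|%:R)) :> rat.
Proof.
rewrite card_proper_colorings_add_vertex sum_proper_colorings_add_vertex.
rewrite mulr_natl -sumr_const; apply: eq_bigr => c cP.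
have BK : B \subset K by rewrite -hABK subsetUr.
have neighE a : extend_coloring c a @: (None |: [set Some b | b in B]) =
    a |: c @: B.
  rewrite imsetU1 ffunE -imset_comp; congr (_ |: _).
  by apply: eq_imset => x /=; rewrite ffunE.
under eq_bigr => a _ do
  rewrite neighE cardsC_natr cardsU1 natrD opprD addrCA addrC.
rewrite big_split /= sumr_const -[X in X + _]mulr_natl cardsC_natr.
rewrite !card_clique_imset // sumrN -natr_sum; congr (_ - _).
(* The remaining sum of indicators counts the colors outside both [c @: A] and [c @: B]. *)
rewrite -(@card_clique_imset l c K) // -cardsC_natr -hABK imsetU setCU.
rewrite -sum1_card big_mkcond [in RHS]big_mkcond /=; congr (_%:R).
by apply: eq_bigr => a _; rewrite in_setI !in_setC; do 2!case: (_ \in _).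
Qed.

Lemma card_proper_colorings_isolated (l : nat) :
  #|proper_colorings
      (disjoint_union (del_vertex (pair_v A B)) (complete 1)) l|%:R =
  #|proper_colorings G0 l|%:R * ((l%:R - #|A|%:R) * l%:R) :> rat.
Proof.
pose G2 := disjoint_union (del_vertex (pair_v A B)) (complete 1).
(* The isolated vertex is viewed as a vertex added with empty neighborhood, so the same summation
   lemma applies twice. *)
pose f (x : G2) : @add_vertex (add_vertex A) set0 :=
  if x is inl y then val y else None.
have f_bij : bijective f.
  pose g (x : option (option G0)) : G2 :=
    if x is Some y then inl (exist _ (Some y) isT) else inr ord0.
  exists g => [|[]//].
  move=> [[[y|] //= hy]|a]; last by rewrite [a]ord1.
  by congr inl; apply: val_inj.
rewrite (@card_proper_colorings_iso _ _ f) //; last first.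
  by move=> [[[x|] hx]|a] [[[y|] hy]|b] //=; rewrite ?inE // [a]ord1 [b]ord1.
rewrite card_proper_colorings_add_vertex sum_proper_colorings_add_vertex.
rewrite [RHS]mulr_natl -sumr_const; apply: eq_bigr => c cP.
under eq_bigr => a _ do rewrite imset0 cardsC_natr cards0 subr0.
by rewrite sumr_const -[LHS]mulr_natl cardsC_natr card_clique_imset.
Qed.

End EdgePair.

(** * Orders and neighborhoods in the constructions *)

Lemma card_add_edge_pair (G0 : sgraph) (A B : {set G0}) :
  #|add_edge_pair A B| = #|G0|.+2.
Proof. by rewrite !card_option. Qed.

Lemma card_isolated (G0 : sgraph) (A B : {set G0}) :
  #|disjoint_union (del_vertex (pair_v A B)) (complete 1)| = #|G0|.+2.
Proof.
rewrite card_sum card_ord card_sig addn1; congr _.+1.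
have := cardC1 (pair_v A B); rewrite !card_option /= => <-.
exact: eq_card.
Qed.

Lemma in_imset_Some (T : finType) (S : {set T}) (x : option T) :
  (x \in Some @: S) = (if x is Some y then y \in S else false).
Proof.
case: x => [y|]; first by rewrite mem_imset // => ? ? [].
by apply/imsetP => -[].
Qed.

Lemma in_nbhd_pair_u (G0 : sgraph) (A B : {set G0}) (x : option (option G0)) :
  (x \in nbhd (pair_u A B)) =
  (if x is Some y then if y is Some a then a \in A else false else true).
Proof.
case: x => [[x|]|]; rewrite inE //=.
by apply: etrans (in_setU1 (None : option G0) _ _) _.
Qed.

Lemma in_nbhd_pair_v (G0 : sgraph) (A B : {set G0}) (x : option (option G0)) :
  (x \in nbhd (pair_v A B)) =
  (if x is Some y then if y is Some b then b \in B else true else false).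
Proof.
case: x => [x|]; rewrite inE //=; apply: etrans (in_setU1 (x : option G0) _ _) _.
by rewrite in_imset_Some; case: x.
Qed.

(** The extra 2 counts [u] and [v], which are neighbors of each other. *)
Lemma card_nbhd_pairU (G0 : sgraph) (A B : {set G0}) :
  #|nbhd (pair_u A B) :|: nbhd (pair_v A B)| = (#|A :|: B| + 2)%N.
Proof.
have some_inj T : injective (@Some T) by move=> y z [].
have -> : nbhd (pair_u A B) :|: nbhd (pair_v A B) =
    None |: (Some None |: Some @: (Some @: (A :|: B))).
  apply/setP => -[[x|]|]; rewrite in_setU in_nbhd_pair_u in_nbhd_pair_v !in_setU1;
    rewrite ?in_imset_Some ?in_setU //.
rewrite !cardsU1 !(card_imset _ (some_inj _)) in_setU1 !in_imset_Some /=.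
by rewrite addnA addnC.
Qed.

Lemma card_nbhd_pairI (G0 : sgraph) (A B : {set G0}) :
  #|nbhd (pair_u A B) :&: nbhd (pair_v A B)| = #|A :&: B|.
Proof.
have some_inj T : injective (@Some T) by move=> y z [].
have -> : nbhd (pair_u A B) :&: nbhd (pair_v A B) = Some @: (Some @: (A :&: B)).
  apply/setP => -[[x|]|]; rewrite in_setI in_nbhd_pair_u in_nbhd_pair_v;
    by rewrite !in_imset_Some ?in_setI.
by rewrite !(card_imset _ (some_inj _)).
Qed.

(** * The numerical inequality and the conclusion *)

(** With [m = j + s - t], the right cross product minus the left one is [(i + j + s) (j - t) - m (m
    - 1) j - (m - 1) s]. The terms quadratic in [i] cancel, and solving for [i] gives the stated
    bound. *)
Lemma extension_ratio_lt (R : realFieldType) (i j s t l : R) :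
  1 <= i -> 2 <= s -> t + 1 <= j -> l = i + j + s - 1 ->
  (j ^+ 3 + 2 * (s - t - 1) * j ^+ 2
     + (t ^+ 2 + 2 * t - 2 * t * s + s ^+ 2 - s) * j + s ^+ 2 - s) / (j - t) < i ->
  0 <= t ->
  ((l - (i + t)) * l) / ((l + 1 - (i + t)) * (l + 1)) <
  ((l - (i + t)) * (l - j) - (l - (i + j))) /
    ((l + 1 - (i + t)) * (l + 1 - j) - (l + 1 - (i + j))).
Proof.
move=> i_ge1 s_ge2 tj -> + t_ge0; rewrite ltr_pdivrMr => [hi|]; last by lra.
have D2_gt0 : 0 < (i + j + s - 1 + 1 - (i + t)) * (i + j + s - 1 + 1).
  by apply: mulr_gt0; lra.
have D1_gt0 : 0 < (i + j + s - 1 + 1 - (i + t)) * (i + j + s - 1 + 1 - j)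
                    - (i + j + s - 1 + 1 - (i + j)).
  (* The denominator equals this product plus [i]. *)
  have : 0 < (j + s - t - 1) * (i + s) by apply: mulr_gt0; lra.
  by lra.
rewrite ltr_pdivrMr // mulrAC ltr_pdivlMr //.
by lra.
Qed.

Theorem theorem2p4 (k s i j t : nat)
  (hk : (2 <= k)%N) (hs : (2 <= s)%N) (hi : (1 <= i)%N) (hj : (1 <= j)%N)
  (G0 : sgraph) (hG0 : #|G0| = (k + s - 2)%N)
  (K : {set G0}) (hK : is_clique K) (hKk : #|K| = k)
  (A B : {set G0}) (hAK : A \subset K) (hBK : B \subset K)
  (hA : #|A| = (i + t)%N) (hB : #|B| = j)
  (hU : #|nbhd (pair_u A B) :|: nbhd (pair_v A B)| = (k + 2)%N)
  (hI : #|nbhd (pair_u A B) :&: nbhd (pair_v A B)| = t)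
  (htj : (t < j)%N)
  (hij : let i' : rat := i%:R in let j' : rat := j%:R in
         let s' : rat := s%:R in let t' : rat := t%:R in
         i' > (j' ^+ 3 + 2 * (s' - t' - 1) * j' ^+ 2
               + (t' ^+ 2 + 2 * t' - 2 * t' * s' + s' ^+ 2 - s') * j'
               + s' ^+ 2 - s') / (j' - t')) :
  mean_color_number (add_edge_pair A B)
  < mean_color_number
      (disjoint_union (del_vertex (pair_v A B)) (complete 1)).

Proof.
have hABK : A :|: B = K.
  apply/eqP; rewrite eqEcard subUset hAK hBK hKk -(leq_add2r 2).
  by rewrite -card_nbhd_pairU hU leqnn.
(* Inclusion-exclusion: [k + t = (i + t) + j]. *)
have k_eq : k = (i + j)%N.
  have := cardsUI A B; rewrite hABK hKk -card_nbhd_pairI hI hA hB; lia.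
(* Both graphs have [k + s] vertices, so [l] is one less than their order. *)
have [l l_eq] : exists l, (k + s)%N = l.+1 by exists (k + s).-1; lia.
have n_eq : #|G0|.+2 = l.+1 by rewrite hG0; lia.
have lE : l%:R = i%:R + j%:R + s%:R - 1 :> rat.
  by rewrite -!natrD -k_eq l_eq -addn1 natrD addrK.
rewrite (@mean_color_numberE _ l) ?card_add_edge_pair //.
rewrite (@mean_color_numberE _ l) ?card_isolated //.
rewrite !(card_proper_colorings_add_edge_pair _ _ _ _ hK) //.
rewrite !(card_proper_colorings_isolated _ _ _ _ hK) //.
have P_gt0 m : (#|G0| <= m)%N -> 0 < #|proper_colorings G0 m|%:R :> rat.
  by move=> ?; rewrite ltr0n proper_colorings_gt0.
have {P_gt0} := (P_gt0 l ltac:(lia), P_gt0 l.+1 ltac:(lia)).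
move: (#|proper_colorings G0 l|%:R : rat) => p.
move: (#|proper_colorings G0 l.+1|%:R : rat) => q [p_gt0 q_gt0].
rewrite hA hB hKk k_eq -natr1 !natrD ltr_pM2l; last by rewrite natr1 ltr0n.
(* The larger mean has the smaller ratio of counts. Both ratios contain the factor [p / q] coming
   from [G0], which cancels. *)
rewrite ltrD2l ltrN2 -!(mulf_div p) ltr_pM2l ?divr_gt0 //.
apply: (@extension_ratio_lt _ _ _ s%:R) => //; first 1 last.
- by rewrite ler_nat.
- by rewrite natr1 ler_nat.
- by rewrite ler1n.
Qed.
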